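(* Let $n \geq 2$ be an integer, $0 < p < 1$, and $T$ a real number with $1 \leq T \leq n$. If $T \geq \left\lceil \frac{4}{3p} \right\rceil$, then $\bar{\mathbf{x}}\left(n,T,m\right)$ with $m = \left\lfloor \left\lfloor \frac{n}{T} \right\rfloor T \right\rfloor$ or $\bar{\mathbf{x}}(n,T,m)$ with $m=n$ is an optimal symmetric allocation (that is, at least one of these two is optimal among symmetric allocations). Both candidate allocations are identical when $\frac{n}{T}$ is a positive integer.
   Context: There are $n$ storage nodes; an allocation stores an amount $x_i \geq 0$ of data in node $i$, with $\sum_{i=1}^n x_i \leq T$. Each node is accessed independently with probability $p$; recovery is successful iff the total amount of data in the accessed nodes is at least $1$. For $m \in \{1,2,\ldots,n\}$, the symmetric allocation $\bar{\mathbf{x}}(n,T,m)$ is the one in which $m$ nodes each store $\frac{T}{m}$ and the remaining $n-m$ nodes store $0$. Its probability of successful recovery is $$P_{\mathrm{S}}(p,T,m) = \mathbb{P}\left[\mathcal{B}(m,p) \geq \left\lceil \tfrac{m}{T} \right\rceil\right],$$ where $\mathcal{B}(m,p)$ denotes a binomial random variable with $m$ trials and success probability $p$. An optimal symmetric allocation is an allocation $\bar{\mathbf{x}}(n,T,m)$ whose $m$ maximizes $P_{\mathrm{S}}(p,T,m)$ over all $m \in \{1,2,\ldots,n\}$. *)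

(* Defs.v *)
From mathcomp Require Export all_boot all_order all_algebra.
From mathcomp Require Export all_classical all_reals all_analysis.

Set Implicit Arguments.
Unset Strict Implicit.
Unset Printing Implicit Defensive.

Import Order.TTheory GRing.Theory Num.Theory.

Local Open Scope ring_scope.

Definition allocation {R : realType} (n : nat) (T : R) (x : 'rV[R]_n) : Prop :=
  (forall i, 0 <= x 0 i) /\ \sum_i x 0 i <= T.

(* The finite sample space is the set of accessed-node sets; independent access
   with probability p gives the set A the weight p^|A| (1-p)^(n-|A|). *)
Definition recovery_prob {R : realType} (n : nat) (p : R) (x : 'rV[R]_n) : R :=
  \sum_(A : {set 'I_n} | 1 <= \sum_(i in A) x 0 i)
    p ^+ #|A| * (1 - p) ^+ (n - #|A|).

Definition sym_alloc {R : realType} (n : nat) (T : R) (m : nat) : 'rV[R]_n :=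
  \row_(i < n) (if (i < m)%N then T / m%:R else 0).

(* [recovery_prob_sym_alloc] below identifies this binomial tail with the
   recovery probability of [sym_alloc n T m]. *)
Definition PS {R : realType} (p T : R) (m : nat) : \bar R :=
  binomial_prob m p [set k : nat | Num.ceil (m%:R / T) <= k%:Z]%classic.

Definition optimal_sym_alloc {R : realType} (n : nat) (p T : R) (x : 'rV[R]_n) :
    Prop :=
  exists m : nat, [/\ (1 <= m <= n)%N, x = sym_alloc n T m &
    forall k : nat, (1 <= k <= n)%N -> (PS p T k <= PS p T m)%E].

Lemma card_ord_lt (n m : nat) : (m <= n)%N -> #|[set i : 'I_n | (i < m)%N]| = m.
Proof.
move=> mn; have inj : injective (widen_ord mn).
  by move=> i j /(congr1 val) /= ij; apply: val_inj.
rewrite -[RHS]card_ord -(card_imset _ inj).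
apply: eq_card => i; rewrite inE; apply/idP/imsetP => [im|[j _ ->]]; last first.
  exact: (ltn_ord j).
by exists (Ordinal im) => //; apply: val_inj.
Qed.

Lemma sum_sym_alloc {R : realType} (n : nat) (T : R) (m : nat) (A : {set 'I_n}) :
  \sum_(i in A) sym_alloc n T m 0 i =
    (T / m%:R) *+ #|A :&: [set i : 'I_n | (i < m)%N]|.
Proof.
rewrite -sumr_const (bigID (fun i : 'I_n => (i < m)%N)) /=.
rewrite [X in _ + X]big1 ?addr0; last first.
  by move=> i /andP[_ /negbTE im]; rewrite mxE im.
apply: eq_big => [i|i /andP[_ im]]; first by rewrite !inE.
by rewrite mxE im.
Qed.

Lemma allocation_sym_alloc {R : realType} (n : nat) (T : R) (m : nat) :
  0 < T -> (1 <= m <= n)%N -> allocation T (sym_alloc n T m).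
Proof.
move=> T0 /andP[m0 mn]; split=> [i|].
  by rewrite mxE; case: ifP => // _; rewrite divr_ge0 // ltW.
have -> : \sum_i sym_alloc n T m 0 i =
    \sum_(i in finset.setTfor 'I_n) sym_alloc n T m 0 i.
  by apply: eq_bigl => i; rewrite finset.in_setT.
rewrite sum_sym_alloc finset.setTI card_ord_lt // -mulr_natr divfK //.
by rewrite pnatr_eq0 -lt0n.
Qed.

Lemma sum_subsets {R : comNzRingType} (I : finType) (D : {set I}) (F : nat -> R)
    (P : pred nat) :
  \sum_(B : {set I} | (B \subset D) && P #|B|) F #|B| =
  \sum_(k < #|D|.+1 | P k) F k *+ 'C(#|D|, k).
Proof.
rewrite (partition_big (fun B : {set I} => inord #|B| : 'I_#|D|.+1)
          (fun k : 'I_#|D|.+1 => P k)) /=; last first.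
  by move=> B /andP[/subset_leq_card BD PB]; rewrite inordK.
apply: eq_bigr => k Pk; rewrite -(cards_draws D k) -sumr_const.
have E (B : {set I}) : [&& B \subset D, P #|B| & inord #|B| == k] =
    (B \in [set B : {set I} | B \subset D & #|B| == k]).
  rewrite inE; case BD: (B \subset D) => //=.
  rewrite -val_eqE /= inordK ?ltnS ?subset_leq_card //.
  by case: eqP => [->|]; rewrite ?Pk ?andbF.
apply: eq_big => [B|B]; first by rewrite -E andbA.
by rewrite -andbA E inE => /andP[_ /eqP ->].
Qed.

Lemma sum_sets_trace {R : comNzRingType} (I : finType) (D : {set I}) (p : R)
    (P : pred nat) :
  \sum_(A : {set I} | P #|A :&: D|) p ^+ #|A| * (1 - p) ^+ (#|I| - #|A|) =
  \sum_(k < #|D|.+1 | P k) (p ^+ k * (1 - p) ^+ (#|D| - k)) *+ 'C(#|D|, k).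
Proof.
rewrite -(sum_subsets D (fun k => p ^+ k * (1 - p) ^+ (#|D| - k)) P).
rewrite (partition_big (fun A : {set I} => A :&: D)
          (fun B : {set I} => (B \subset D) && P #|B|)) /=; last first.
  by move=> A PA; rewrite finset.subsetIr.
apply: eq_bigr => B /andP[BD PB].
rewrite (reindex_onto (fun C => B :|: C) (fun A => A :\: D)) /=; last first.
  by move=> A /andP[_ /eqP <-]; rewrite finset.setID.
have cond C : (P #|(B :|: C) :&: D| && ((B :|: C) :&: D == B)) &&
    ((B :|: C) :\: D == C) = (C \subset ~: D) && true.
  rewrite finset.setIUl finset.setDUl (finset.setIidPl BD).
  have -> : B :\: D = finset.set0 by apply/eqP; rewrite finset.setD_eq0.
  rewrite finset.set0U andbT; apply/idP/idP => [/andP[_ /eqP <-]|CD].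
    by rewrite finset.setDE finset.subsetIr.
  have -> : C :&: D = finset.set0.
    by apply/eqP; rewrite finset.setI_eq0 finset.disjoints_subset.
  rewrite finset.setU0 PB eqxx /=; apply/eqP/finset.setDidPl.
  by rewrite finset.disjoints_subset.
rewrite (eq_bigl _ _ cond).
transitivity (\sum_(C : {set I} | (C \subset ~: D) && true)
   (p ^+ #|B| * (1 - p) ^+ (#|D| - #|B|)) *
   (p ^+ #|C| * (1 - p) ^+ (#|~: D| - #|C|))).
  apply: eq_bigr => C; rewrite andbT => CD.
  have BC : [disjoint B & C].
    rewrite finset.disjoints_subset; apply: (fintype.subset_trans BD).
    by rewrite -finset.setCS finset.setCK.
  rewrite cardsU (_ : B :&: C = finset.set0); last first.
    by apply/eqP; rewrite finset.setI_eq0.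
  rewrite cards0 subn0 -(cardsC D).
  have h1 := subset_leq_card BD; have h2 := subset_leq_card CD.
  rewrite (_ : (_ - (_ + _) = (#|D| - #|B|) + (#|~: D| - #|C|))%N).
    by rewrite !exprD mulrACA.
  by rewrite subnDA addnC -addnBA // addnC -addnBA.
rewrite -big_distrr /=.
rewrite (sum_subsets (~: D) (fun k => p ^+ k * (1 - p) ^+ (#|~: D| - k)) predT).
have := exprDn (1 - p) p #|~: D|; rewrite subrK expr1n => E.
rewrite -[RHS]mulr1; congr (_ * _); rewrite [RHS]E.
by apply: eq_bigr => k _; rewrite mulrC.
Qed.

Lemma recovery_prob_sym_alloc {R : realType} (n : nat) (p T : R) (m : nat) :
  0 <= p <= 1 -> 0 < T -> (1 <= m <= n)%N ->
  (recovery_prob p (sym_alloc n T m))%:E = PS p T m.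
Proof.
move=> p01 T0 /andP[m0 mn]; have /andP[p0 p1] := p01.
set D := [set i : 'I_n | (i < m)%N]; have cD : #|D| = m by exact: card_ord_lt.
have m0' : 0 < m%:R :> R by rewrite ltr0n.
have E (A : {set 'I_n}) : (1 <= \sum_(i in A) sym_alloc n T m 0 i) =
    (Num.ceil (m%:R / T) <= #|A :&: D|%:Z).
  by rewrite sum_sym_alloc ceil_le_int ler_pdivrMr // -mulr_natr mulrAC
    ler_pdivlMr // mul1r mulrC.
rewrite /recovery_prob (eq_bigl _ _ E).
have := sum_sets_trace D p (fun k => Num.ceil (m%:R / T) <= k%:Z).
rewrite card_ord cD => ->.
rewrite /PS (@binomial_msum R m p p0 p1) /msum /mscale /= big_mkcond -sumEFin.
apply: eq_bigr => k _; rewrite /mscale /= diracE.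
by case: ifPn => h; [rewrite mem_set // mule1|rewrite memNset ?mule0 //; apply/negP].
Qed.

(* Main.v *)
(* For a threshold k the best m is the largest one with ceil (m / T) <= k,
   namely floor (k T), or n when k is the last threshold, so it suffices that
   P[B(floor (k T)) >= k] is nondecreasing in k.  Put m = floor (k T) and
   t = floor T: one more threshold buys at least t more trials.  Among these,
   a further success is lost only when B(m) = k and no new trial succeeds, while
   recovery is gained at least when B(m) = k - 1 and two new trials succeed.
   Since m < k (t + 1), P[B(m) = k] <= (t p / q) P[B(m) = k - 1] with q = 1 - p,
   and the comparison reduces to P[B(t) = 1] <= P[B(t) >= 2], that is
   1 + 2 t y <= (1 + y)^t for y = p / q.  This holds as soon as
   y >= 4 / (3 t - 4), i.e. t p >= 4 / 3, with equality for t = 2. *)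
Require Import Defs.
From mathcomp Require Import ring lra zify.
Import Order.TTheory GRing.Theory Num.Theory.

Local Open Scope ring_scope.

(** * Polynomial inequalities behind the constant [4 / 3] *)

Lemma le_of_eq {R : realFieldType} {x y : R} : x = y -> x <= y.
Proof. by move->. Qed.

(** This is the binomial expansion cut after degree four. Multiplying the cut expansion for [t] by
    [1 + y] gives the one for [t + 1] plus ['C(t, 4) y^5], which is nonnegative. *)
Lemma exprD1_ge_quartic {R : realFieldType} {y : R} (t : nat) : 0 <= y ->
  1 + t%:R * y + t%:R * (t%:R - 1) / 2 * y ^+ 2
    + t%:R * (t%:R - 1) * (t%:R - 2) / 6 * y ^+ 3
    + t%:R * (t%:R - 1) * (t%:R - 2) * (t%:R - 3) / 24 * y ^+ 4
  <= (1 + y) ^+ t.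
Proof.
move=> y0; elim: t => [|t IH].
  by rewrite expr0 !mul0r !addr0.
have rest : 0 <= t%:R * (t%:R - 1) * (t%:R - 2) * (t%:R - 3) / 24 * y ^+ 5.
  rewrite mulr_ge0 ?exprn_ge0 // divr_ge0 //.
  move: t {IH} => [|[|[|[|t]]]]; rewrite ?mulr0 ?mul0r ?subrr ?mulr0 ?mul0r //.
have y1 : 0 <= 1 + y by lra.
rewrite [(1 + y) ^+ t.+1]exprS; apply: le_trans (ler_wpM2l y1 IH).
rewrite -subr_ge0; apply: le_trans rest _.
by rewrite -natr1; apply: le_of_eq; field.
Qed.

Lemma bernoulli_double {R : realFieldType} {y : R} {t : nat} : (2 <= t)%N ->
  4 / (3 * t%:R - 4) <= y -> 1 + 2 * t%:R * y <= (1 + y) ^+ t.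
Proof.
move=> /subnK <-; move: (t - 2)%N => a.
have a0 : 0 <= a%:R :> R by [].
have aa : a%:R <= a%:R ^+ 2 :> R.
  by rewrite -natrX ler_nat; case: a {a0} => // a; rewrite leq_pmull.
rewrite natrD.
have -> : 3 * (a%:R + 2) - 4 = 3 * a%:R + 2 :> R by ring.
set x := a%:R in a0 aa *; set z := 4 / (3 * x + 2) => zy.
have z0 : 0 <= z by rewrite divr_ge0 //; lra.
have y0 : 0 <= y by apply: le_trans zy.
have := exprD1_ge_quartic (a + 2) y0; rewrite natrD -/x; apply: le_trans.
have u0 : 0 <= x ^+ 2 - x by lra.
(* With [t = x + 2], the quartic bound minus [1 + 2 t y] equals [t y (f y - 1)]. As [f] is
   nondecreasing on nonnegative reals, only the endpoint [z] has to be checked. *)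
pose f w := (x + 1) / 2 * w + (x + 1) * x / 6 * w ^+ 2
  + (x + 1) * (x ^+ 2 - x) / 24 * w ^+ 3.
have fz : 1 <= f z.
  rewrite -subr_ge0 (_ : _ - _ = (5 * x * (x ^+ 2 - x) + 9 * (x ^+ 2 - x)
    + 5 * x) / (3 * (3 * x + 2) ^+ 3)); last by rewrite /f /z; field; lra.
  by rewrite divr_ge0 ?mulr_ge0 ?exprn_ge0 ?addr_ge0 // ?mulr_ge0.
have fy : 1 <= f y.
  apply: le_trans fz _; have x1 : 0 <= x + 1 by lra.
  by rewrite !lerD // ler_wpM2l ?lerXn2r // divr_ge0 // mulr_ge0.
rewrite -subr_ge0.
rewrite (_ : _ - _ = (x + 2) * y * (f y - 1)); last by rewrite /f; field.
by rewrite !mulr_ge0 //; lra.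
Qed.

(** Divided by [1 - p], this reads [2 P[B(t) = 1] + P[B(t) = 0] <= 1]. It is [bernoulli_double] at
    [y = p / (1 - p)], scaled by [(1 - p)^(t + 1)]. *)
Lemma binomial_low_mass {R : realFieldType} {p : R} {t : nat} : 0 < p < 1 ->
  4 <= 3 * t%:R * p ->
  2 * t%:R * p * (1 - p) ^+ t + (1 - p) ^+ t.+1 <= 1 - p.
Proof.
move=> /andP[p0 p1] tp; have q0 : 0 < 1 - p by lra.
have t2 : (2 <= t)%N by move: t tp => [|[|t]] //; lra.
have t2R : 2 <= t%:R :> R by rewrite ler_nat.
have tl : 4 / (3 * t%:R - 4) <= p / (1 - p).
  have d0 : 0 < 3 * t%:R - 4 :> R by lra.
  by rewrite ler_pdivrMr // [leRHS]mulrAC ler_pdivlMr //; lra.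
have := bernoulli_double t2 tl.
have -> : 1 + p / (1 - p) = (1 - p)^-1 by field; lra.
rewrite exprVn -[leRHS]div1r ler_pdivlMr ?exprn_gt0 // => /(ler_wpM2l (ltW q0)).
rewrite mulr1; apply: le_trans; rewrite exprS.
by apply: le_of_eq; field; lra.
Qed.

(** * Binomial probabilities as trials are added *)

Definition binomial_cdf_lt {R : realType} (m : nat) (p : R) (k : nat) : R :=
  \sum_(i < k) binomial_pmf m p i.

Lemma binomial_pmfE {R : realType} (m : nat) (p : R) (k : nat) :
  binomial_pmf m p k = p ^+ k * (1 - p) ^+ (m - k) *+ 'C(m, k).
Proof. by []. Qed.

Lemma binomial_pmfS0 {R : realType} (m : nat) (p : R) :
  binomial_pmf m.+1 p 0 = (1 - p) * binomial_pmf m p 0.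
Proof. by rewrite !binomial_pmfE !bin0 !subn0 !expr0 !mul1r exprS. Qed.

Lemma binomial_pmfSS {R : realType} (m : nat) (p : R) (i : nat) :
  binomial_pmf m.+1 p i.+1 =
  (1 - p) * binomial_pmf m p i.+1 + p * binomial_pmf m p i.
Proof.
rewrite !binomial_pmfE binS mulrnDr subSS; congr (_ + _).
  case: (leqP i.+1 m) => im; last by rewrite bin_small // !mulr0n mulr0.
  by rewrite -(subnSK im) [(1 - p) ^+ _.+1]exprS mulrCA mulrnAr.
by rewrite exprS -mulrA mulrnAr.
Qed.

Lemma binomial_pmf_ratio {R : realType} (m : nat) (p : R) (j : nat) :
  j.+1%:R * (1 - p) * binomial_pmf m p j.+1 =
  (m - j)%:R * p * binomial_pmf m p j.
Proof.
rewrite !binomial_pmfE.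
(* For [m <= j] both sides vanish, the right one because [m - j] is truncated. *)
have [jm|mj] := ltnP j m; last first.
  by rewrite bin_small // mulr0n mulr0 (eqP (_ : (m - j == 0)%N)) ?mul0r.
have E : j.+1%:R * 'C(m, j.+1)%:R = (m - j)%:R * 'C(m, j)%:R :> R.
  by rewrite -!natrM mul_bin_left.
rewrite -[_ *+ 'C(m, j.+1)]mulr_natr -[_ *+ 'C(m, j)]mulr_natr.
rewrite -(subnSK jm) !exprS.
transitivity (p * p ^+ j * (1 - p) * (1 - p) ^+ (m - j.+1)
              * (j.+1%:R * 'C(m, j.+1)%:R)); first by ring.
by rewrite E -(subnSK jm); ring.
Qed.

(** A new trial lifts the count out of the range below [k + 1] exactly when the first [m] trials
    give [k] successes and the new one succeeds. *)
Lemma binomial_cdf_ltSS {R : realType} (m : nat) (p : R) (k : nat) :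
  binomial_cdf_lt m.+1 p k.+1 =
  binomial_cdf_lt m p k.+1 - p * binomial_pmf m p k.
Proof.
elim: k => [|k IH]; rewrite /binomial_cdf_lt big_ord_recr.
  by rewrite !big_ord0 big_ord_recr big_ord0 /= binomial_pmfS0; ring.
rewrite /binomial_cdf_lt in IH; rewrite IH /= [in RHS]big_ord_recr /=.
by rewrite binomial_pmfSS; ring.
Qed.

Lemma le_binomial_cdf_lt {R : realType} (m : nat) {p : R} {k k' : nat} :
  0 <= p <= 1 -> (k <= k')%N -> binomial_cdf_lt m p k <= binomial_cdf_lt m p k'.
Proof.
move=> p01 /subnK <-; elim: (k' - k)%N => [|d IH] //.
rewrite addSn /binomial_cdf_lt big_ord_recr; apply: le_trans IH _.
by rewrite lerDl binomial_pmf_ge0.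
Qed.

Lemma ge_binomial_cdf_lt {R : realType} {m m' : nat} {p : R} (k : nat) :
  0 <= p <= 1 -> (m <= m')%N -> binomial_cdf_lt m' p k <= binomial_cdf_lt m p k.
Proof.
move=> p01 /subnK <-; elim: (m' - m)%N => [|d IH] //; apply: le_trans IH.
case: k => [|k]; first by rewrite /binomial_cdf_lt !big_ord0.
rewrite binomial_cdf_ltSS gerBl mulr_ge0 ?binomial_pmf_ge0 //.
by case/andP: p01.
Qed.

(* The two summands are the contributions of no success, and of exactly one
   success, in the last [s] trials; the extra factor [1 - p] avoids the exponent
   [s - 1]. *)
Lemma binomial_pmf_addn_ge {R : realType} (m s : nat) {p : R} (j : nat) :
  0 <= p <= 1 ->
  (1 - p) ^+ s.+1 * binomial_pmf m p j.+1
    + s%:R * p * (1 - p) ^+ s * binomial_pmf m p j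
  <= (1 - p) * binomial_pmf (s + m) p j.+1.
Proof.
move=> p01; have /andP[p0 p1] := p01; have q0 : 0 <= 1 - p by lra.
have no_success s' i :
    (1 - p) ^+ s' * binomial_pmf m p i <= binomial_pmf (s' + m) p i.
  elim: s' => [|s' IH]; first by rewrite expr0 mul1r.
  rewrite exprS -mulrA addSn; apply: le_trans (ler_wpM2l q0 IH) _.
  case: i {IH} => [|i]; first by rewrite binomial_pmfS0.
  by rewrite binomial_pmfSS lerDl mulr_ge0 ?binomial_pmf_ge0.
elim: s => [|s IH]; first by rewrite !mul0r addr0 expr1.
rewrite addSn binomial_pmfSS mulrDr [X in _ <= _ + X]mulrA.
have := lerD (ler_wpM2l q0 IH) (ler_wpM2l (mulr_ge0 q0 p0) (no_success s j)).
rewrite (exprS _ s.+1) (exprS _ s) -[s.+1%:R]natr1; apply: le_trans.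
by apply: le_of_eq; ring.
Qed.

(** Divided by [1 - p], the coefficients are [P[B(t) >= 1]] and [P[B(t) >= 2]]: the new trials must
    supply the one or two successes missing from [j + 2]. *)
Lemma binomial_cdf_lt_drop {R : realType} (m t : nat) {p : R} (j : nat) :
  0 <= p <= 1 ->
  (1 - p) * (1 - (1 - p) ^+ t) * binomial_pmf m p j.+1
    + ((1 - p) * (1 - (1 - p) ^+ t) - t%:R * p * (1 - p) ^+ t)
      * binomial_pmf m p j
  <= (1 - p) * (binomial_cdf_lt m p j.+2 - binomial_cdf_lt (t + m) p j.+2).
Proof.
move=> p01; have /andP[p0 p1] := p01.
elim: t => [|t IH]; first by rewrite expr0 add0n; lra.
rewrite addSn binomial_cdf_ltSS.
have := lerD IH (ler_wpM2l p0 (binomial_pmf_addn_ge m t j p01)).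
rewrite -[t.+1%:R]natr1 (exprS _ t) -subr_ge0 => H; rewrite -subr_ge0.
by apply: le_trans H _; apply: le_of_eq; ring.
Qed.

Lemma binomial_cdf_lt_addn {R : realType} {m t : nat} {p : R} {j : nat} :
  0 < p < 1 -> 4 <= 3 * t%:R * p -> (m <= j.+1 * t + j)%N ->
  binomial_cdf_lt (t + m) p j.+2 <= binomial_cdf_lt m p j.+1.
Proof.
move=> /andP[p0 p1] tp mj; have q0 : 0 < 1 - p by lra.
have p01 : 0 <= p <= 1 by rewrite !ltW.
have /andP[p0' p1'] := p01.
have bj := binomial_pmf_ge0 m j p01.
(* The bound on [m] amounts to [m - j <= (j + 1) t]. *)
have ratio : (1 - p) * binomial_pmf m p j.+1 <= t%:R * p * binomial_pmf m p j.
  rewrite -(ler_pM2l (_ : 0 < j.+1%:R)) // !mulrA binomial_pmf_ratio.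
  by rewrite -natrM !ler_wpM2r // ler_nat; lia.
have low := binomial_low_mass (introT andP (conj p0 p1)) tp.
have drop := binomial_cdf_lt_drop m t j p01.
have E : binomial_cdf_lt m p j.+2 =
    binomial_cdf_lt m p j.+1 + binomial_pmf m p j.+1.
  by rewrite /binomial_cdf_lt big_ord_recr.
have qt : 0 <= (1 - p) ^+ t by rewrite exprn_ge0 // ltW.
have h1 := ler_wpM2l qt ratio; have h2 := ler_wpM2r bj low.
rewrite -(ler_pM2l q0); rewrite E in drop; rewrite exprS in h2.
by lra.
Qed.

(** * From recovery probabilities to failure probabilities, and rounding *)

Lemma PS_cdf {R : realType} {p T : R} (m : nat) : 0 <= p <= 1 -> 0 <= T ->
  PS p T m = (1 - binomial_cdf_lt m p `|Num.ceil (m%:R / T)|)%:E.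
Proof.
move=> p01 T0; rewrite /PS.
set c := Num.ceil _; have c0 : 0 <= c.
  by rewrite ceil_ge0 (lt_le_trans (ltrN10 _)) // divr_ge0.
have -> : [set k : nat | c <= k%:Z]%classic = (~` `I_`|c|)%classic.
  by apply/seteqP; split=> k /=; [move=> ck|move/negP]; lia.
rewrite probability_setC // EFinB; congr (_ - _)%E.
rewrite -[LHS]/(binomial_prob m p `I_`|c|) /binomial_prob p01.
rewrite esum_fset //=; last first.
  by move=> i _; rewrite lee_fin binomial_pmf_ge0.
by rewrite -fsbig_ord sumEFin.
Qed.

Lemma truncn_mulrSn_ge {R : realType} {T : R} (k : nat) : 0 <= T ->
  (Num.trunc T + Num.trunc (k%:R * T) <= Num.trunc (k.+1%:R * T))%N.
Proof.
move=> T0; have kT : 0 <= k%:R * T by rewrite mulr_ge0.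
rewrite truncn_ge_nat ?mulr_ge0 // natrD -[k.+1%:R]natr1 mulrDl mul1r addrC.
by rewrite lerD // truncn_le.
Qed.

Lemma truncn_mulrn_lt {R : realType} {T : R} {k : nat} : 0 <= T -> (0 < k)%N ->
  (Num.trunc (k%:R * T) < k * (Num.trunc T).+1)%N.
Proof.
move=> T0 k0; rewrite truncn_lt_nat ?mulr_ge0 // natrM ltr_pM2l ?ltr0n //.
by have /andP[] := truncn_itv T0.
Qed.

Lemma binomial_cdf_lt_mulrn {R : realType} {p T : R} {k k' : nat} :
  0 < p < 1 -> 0 <= T -> 4 <= 3 * (Num.trunc T)%:R * p ->
  (0 < k <= k')%N ->
  binomial_cdf_lt (Num.trunc (k'%:R * T)) p k'
    <= binomial_cdf_lt (Num.trunc (k%:R * T)) p k.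
Proof.
move=> p01 T0 tp /andP[k0 /subnK <-]; elim: (k' - k)%N => [|d IH] //.
apply: le_trans IH; have p01' : 0 <= p <= 1 by lra.
case: k k0 => // k _; rewrite addSn !addnS.
(* The threshold step uses exactly [Num.trunc T] new trials; any further trial only lowers the
   failure probability. *)
apply: le_trans (binomial_cdf_lt_addn p01 tp _).
  exact: ge_binomial_cdf_lt (truncn_mulrSn_ge _ T0).
by have := truncn_mulrn_lt T0 (ltn0Sn (d + k)); lia.
Qed.

Theorem theorem2 (R : realType) (n : nat) (p T : R) (hn : (2 <= n)%N)
    (hp : 0 < p < 1) (hT : 1 <= T <= n%:R) :
  let m0 := `|Num.floor ((Num.floor (n%:R / T))%:~R * T)|%N in
  ((Num.ceil (4 / (3 * p)))%:~R <= T ->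
     optimal_sym_alloc p T (sym_alloc n T m0) \/
     optimal_sym_alloc p T (sym_alloc n T n)) /\
  ((exists k : nat, (0 < k)%N /\ n%:R / T = k%:R) ->
     sym_alloc n T m0 = sym_alloc n T n).
Proof.
have /andP[T1 Tn] := hT; have T0 : 0 < T by lra.
have p01 : 0 <= p <= 1 by lra.
have nT0 : 0 <= n%:R / T by rewrite divr_ge0 // ltW.
set K := Num.trunc (n%:R / T).
have K0 : (0 < K)%N by rewrite truncn_gt0 ler_pdivlMr // mul1r.
have floorE (x : R) : 0 <= x -> Num.floor x = (Num.trunc x)%:Z.
  by move=> x0; rewrite truncn_floor x0 gez0_abs // floor_ge0.
rewrite (floorE _ nT0) -/K -pmulrn.
have -> : `|Num.floor (K%:R * T)|%N = Num.trunc (K%:R * T).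
  by rewrite floorE // mulr_ge0 // ltW.
move=> m0; split=> [hc|[k [k0 nk]]]; last first.
  by rewrite /m0 /K nk natrK -nk divfK ?natrK // gt_eqF.
(* The ceiling in the hypothesis matters here: an integer below [T] is also below its floor. *)
have tp : 4 <= 3 * (Num.trunc T)%:R * p.
  have c_le : 4 / (3 * p) <= (Num.trunc T)%:R.
    apply: le_trans (ceil_ge _) _.
    by rewrite [leRHS]pmulrn -(floorE _ (ltW T0)) ler_int floor_ge_int.
  by move: c_le; rewrite ler_pdivrMr; lra.
have m0_gt0 : (0 < m0)%N.
  by rewrite truncn_gt0; apply: le_trans T1 _; rewrite ler_peMl ?ler1n // ltW.
have m0_le : (m0 <= n)%N.
  have KT : K%:R * T <= n%:R by rewrite -ler_pdivlMr // truncn_le.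
  rewrite -(ler_nat R); apply: le_trans KT.
  by rewrite truncn_le mulr_ge0 // ltW.
pose thr m := `|Num.ceil (m%:R / T)|%N.
have thr_le (m k : nat) : (thr m <= k)%N = (m%:R <= k%:R * T).
  have c0 : 0 <= Num.ceil (m%:R / T).
    by rewrite ceil_ge0 (lt_le_trans (ltrN10 _)) // divr_ge0 // ltW.
  rewrite -ler_pdivrMr // [RHS](_ : _ = (m%:R / T <= k%:Z%:~R)) // -ceil_le_int.
  by rewrite /thr -lez_nat gez0_abs.
have best m : (1 <= m <= n)%N ->
    binomial_cdf_lt m0 p (thr m0) <= binomial_cdf_lt m p (thr m) \/
    binomial_cdf_lt n p (thr n) <= binomial_cdf_lt m p (thr m).
  move=> /andP[m1 mn].
  have mthr : m%:R <= (thr m)%:R * T by rewrite -thr_le.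
  (* If [thr m <= K], enlarge [m] to the floor of [thr m * T], then raise the threshold to [K],
     reaching [m0]. Otherwise [n <= (K + 1) T] gives [thr n <= K + 1 <= thr m], so [n] has at least
     as many trials and no larger threshold. *)
  have [thrK|Kthr] := leqP (thr m) K.
    left; apply: (@le_trans _ _ (binomial_cdf_lt m0 p K)).
      by rewrite le_binomial_cdf_lt // thr_le truncn_le mulr_ge0 // ltW.
    have thr0 : (0 < thr m)%N.
      by rewrite ltnNge thr_le mul0r lern0 -lt0n.
    have thr_itv : (0 < thr m <= K)%N by rewrite thr0.
    apply: le_trans (binomial_cdf_lt_mulrn hp (ltW T0) tp thr_itv) _.
    by rewrite ge_binomial_cdf_lt // truncn_ge_nat // mulr_ge0 // ltW.
  right; apply: le_trans (ge_binomial_cdf_lt _ p01 mn).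
  rewrite le_binomial_cdf_lt // (leq_trans _ Kthr) // thr_le -ler_pdivrMr //.
  by have /andP[_ /ltW] := truncn_itv nT0.
have [nm|/ltW mn] :=
  leP (binomial_cdf_lt n p (thr n)) (binomial_cdf_lt m0 p (thr m0)).
  right; exists n; split=> // [|m mI]; first by rewrite leqnn (ltnW hn).
  rewrite !PS_cdf ?(ltW T0) // lee_fin lerD2l lerN2.
  by case: (best m mI) => //; apply: le_trans.
left; exists m0; split=> // [|m mI]; first by rewrite m0_gt0.
rewrite !PS_cdf ?(ltW T0) // lee_fin lerD2l lerN2.
by case: (best m mI) => //; apply: le_trans.
Qed.
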